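(* Let $\mathfrak A$ be a model with universe $A$ of a vocabulary $\tau$, let $S=\{t_a:a\in A\}$ be a set of closed terms of $\tau$ where each $t_a$ is a term for $a$, and let $\mathrm{T}$ be a theory in $\tau$. Let $\vdash$ be a provability relation. Assume that $[\mathrm{T},\vdash]\subseteq\mathrm{Th}(\mathfrak A)$ and that, whenever $\varphi$ is an atomic or negated atomic formula and $\bar\varphi$ is obtained from $\varphi$ by substituting terms of $S$ for all its free variables, $\mathrm{T}\vdash\bar\varphi$ iff $\mathfrak A\vDash\bar\varphi$. Then for all sentences $\sigma$, $\mathrm{T}\vdash_S\sigma$ iff $\mathfrak A\vDash\sigma$; i.e., $[\mathrm{T},\vdash_S]=\mathrm{Th}(\mathfrak A)$.
   Context: First-order finitary logic. A provability relation $\vdash$ means the provability generated by the standard axioms and rules of classical first-order logic, or any stronger provability relation. For a set $S$ of closed terms, the $S$-rule infers $\forall x\,\varphi(x)$ from the premises $\{\varphi(t):t\in S\}$, for each formula $\varphi$ with single free variable $x$; $\vdash_S$ is the provability generated by $\vdash$ together with the $S$-rule. $[\mathrm{T},\vdash]=\{\varphi:\mathrm{T}\vdash\varphi\}$, and $\mathrm{Th}(\mathfrak A)$ is the set of sentences true in $\mathfrak A$. A closed term $t$ is a term for $a\in A$ iff the set of elements of $\mathfrak A$ defined by the formula $x=t$ is $\{a\}$ (i.e., $t$ is interpreted as $a$). *)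

(* Defs.v *)
From mathcomp Require Import all_boot.
From mathcomp Require Import boolp classical_sets.

Set Implicit Arguments.
Unset Strict Implicit.
Unset Printing Implicit Defensive.

Local Open Scope classical_set_scope.

(* Symbols of arity 0 are allowed: constants and propositional atoms. *)
Record vocabulary := Vocabulary {
  fsym : Type;
  farity : fsym -> nat;
  rsym : Type;
  rarity : rsym -> nat }.

Definition upd (X : Type) (v : nat -> X) (x : nat) (a : X) : nat -> X :=
  fun y => if y == x then a else v y.

Section Syntax.
Variable L : vocabulary.

(* Variables are named by natural numbers. *)
Inductive term :=
| Var (x : nat)
| App (f : fsym L) (ts : 'I_(farity f) -> term).

(* The other connectives and the existential quantifier are the usual
   classical abbreviations. *)
Inductive formula :=
| Eq (t u : term)
| Rel (r : rsym L) (ts : 'I_(rarity r) -> term)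
| Neg (phi : formula)
| Imp (phi psi : formula)
| All (x : nat) (phi : formula).

Fixpoint occurs (x : nat) (t : term) : Prop :=
  match t with
  | Var y => x = y
  | App f ts => exists i, occurs x (ts i)
  end.

Fixpoint free (x : nat) (phi : formula) : Prop :=
  match phi with
  | Eq t u => occurs x t \/ occurs x u
  | Rel r ts => exists i, occurs x (ts i)
  | Neg psi => free x psi
  | Imp psi chi => free x psi \/ free x chi
  | All y psi => x <> y /\ free x psi
  end.

Definition closed_term (t : term) := forall x, ~ occurs x t.

Definition sentence (phi : formula) := forall x, ~ free x phi.

Definition theory (T : set formula) := T `<=` sentence.

Definition atomic (phi : formula) : Prop :=
  match phi with Eq _ _ | Rel _ _ => True | _ => False end.

Definition literal (phi : formula) :=
  atomic phi \/ exists2 psi, atomic psi & phi = Neg psi.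

Fixpoint tsubst (s : nat -> term) (t : term) : term :=
  match t with
  | Var x => s x
  | App f ts => App (fun i => tsubst s (ts i))
  end.

(* Simultaneous replacement of the free variables; bound variables are not
   renamed, whence the side condition [free_for] below. *)
Fixpoint fsubst (s : nat -> term) (phi : formula) : formula :=
  match phi with
  | Eq t u => Eq (tsubst s t) (tsubst s u)
  | Rel r ts => Rel (fun i => tsubst s (ts i))
  | Neg psi => Neg (fsubst s psi)
  | Imp psi chi => Imp (fsubst s psi) (fsubst s chi)
  | All x psi => All x (fsubst (upd s x (Var x)) psi)
  end.

Definition fsubst1 (phi : formula) (x : nat) (t : term) : formula :=
  fsubst (upd Var x t) phi.

(* No free occurrence of [x] in [phi] is in the scope of a quantifier that
   binds a variable of [t]. *)
Fixpoint free_for (t : term) (x : nat) (phi : formula) : Prop :=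
  match phi with
  | Eq _ _ | Rel _ _ => True
  | Neg psi => free_for t x psi
  | Imp psi chi => free_for t x psi /\ free_for t x chi
  | All y psi => ~ free x (All y psi) \/ (~ occurs y t /\ free_for t x psi)
  end.

(* Hilbert calculus for classical first-order logic with equality. *)
Inductive fo_axiom : set formula :=
| ax_K phi psi : fo_axiom (Imp phi (Imp psi phi))
| ax_S phi psi chi :
    fo_axiom (Imp (Imp phi (Imp psi chi)) (Imp (Imp phi psi) (Imp phi chi)))
| ax_contra phi psi :
    fo_axiom (Imp (Imp (Neg phi) (Neg psi)) (Imp psi phi))
| ax_inst x phi t of free_for t x phi :
    fo_axiom (Imp (All x phi) (fsubst1 phi x t))
| ax_distr x phi psi of ~ free x phi :
    fo_axiom (Imp (All x (Imp phi psi)) (Imp phi (All x psi)))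
| ax_refl t : fo_axiom (Eq t t)
| ax_leibniz t u x phi of free_for t x phi & free_for u x phi :
    fo_axiom (Imp (Eq t u) (Imp (fsubst1 phi x t) (fsubst1 phi x u))).

(* A rule relates a set of premises to a conclusion. *)
Definition rules := set formula -> formula -> Prop.

Inductive fo_rule : rules :=
| modus_ponens phi psi : fo_rule [set phi; Imp phi psi] psi
| generalization x phi : fo_rule [set phi] (All x phi).

Inductive S_rule (S : set term) : rules :=
| S_rule_intro phi x of (forall y, free y phi <-> y = x) :
    S_rule S [set fsubst1 phi x t | t in S] (All x phi).

Inductive generated (X : set formula) (R : rules) : set formula :=
| gen_base phi of X phi : generated X R phi
| gen_rule Gamma phi of R Gamma phi & Gamma `<=` generated X R :
    generated X R phi.

Definition closed_under (R : rules) (X : set formula) :=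
  forall Gamma phi, R Gamma phi -> Gamma `<=` X -> X phi.

(* [pr T phi] reads "T proves phi". *)
Definition provability := set formula -> set formula.

Definition fo_provable : provability :=
  fun T => generated (T `|` fo_axiom) fo_rule.

(* First-order provability or anything stronger: what [T] proves contains [T]
   and the logical axioms, and is closed under the rules of first-order
   logic. *)
Definition provability_relation (pr : provability) :=
  forall T, theory T -> T `|` fo_axiom `<=` pr T /\ closed_under fo_rule (pr T).

(* The least provability relation that contains [pr] and is closed under the
   S-rule: from [T] it generates everything from what [pr] proves from [T], by
   the first-order rules and the S-rule. Inference rules of [pr] beyond the
   first-order ones are not re-applied to conclusions of the S-rule: such a
   rule could have premises that are true in a model but become provable only
   through the S-rule, and a conclusion that is false there. *)
Definition S_provable (pr : provability) (S : set term) : provability :=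
  fun T => generated (pr T) (fun Gamma phi =>
    fo_rule Gamma phi \/ S_rule S Gamma phi).

Definition theorems (T : set formula) (pr : provability) : set formula :=
  [set phi | sentence phi /\ pr T phi].

Lemma fo_provable_provability : provability_relation fo_provable.
Proof.
move=> T _; split=> [phi|Gamma phi]; first exact: gen_base.
exact: gen_rule.
Qed.

Lemma fo_provable_least (pr : provability) (T : set formula) :
  provability_relation pr -> theory T -> fo_provable T `<=` pr T.
Proof.
move=> prP /prP[sub clo] phi; elim=> {phi} [phi /sub //|Gamma phi R _ IH].
exact: clo R IH.
Qed.

Lemma S_provable_provability (pr : provability) (S : set term) :
  provability_relation pr -> provability_relation (S_provable pr S).
Proof.
move=> prP T /prP[sub _]; split=> [phi /sub|Gamma phi R]; first exact: gen_base.
by apply: gen_rule; left.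
Qed.

Lemma S_provable_least (pr pr' : provability) (S : set term) (T : set formula) :
  provability_relation pr' -> theory T -> pr T `<=` pr' T ->
  closed_under (S_rule S) (pr' T) -> S_provable pr S T `<=` pr' T.
Proof.
move=> prP /prP[_ clo] sub cloS phi.
elim=> {phi} [phi /sub //|Gamma phi [R|R] _ IH]; first exact: clo R IH.
exact: cloS R IH.
Qed.

End Syntax.

Section Semantics.
Variable L : vocabulary.

Record model := Model {
  universe : Type;
  universe_inhabited : inhabited universe;
  finterp : forall f : fsym L, ('I_(farity f) -> universe) -> universe;
  rinterp : forall r : rsym L, ('I_(rarity r) -> universe) -> Prop }.

Variable A : model.

Fixpoint eval (v : nat -> universe A) (t : term L) : universe A :=
  match t with
  | Var x => v x
  | App f ts => finterp (fun i => eval v (ts i))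
  end.

Fixpoint sat (v : nat -> universe A) (phi : formula L) : Prop :=
  match phi with
  | Eq t u => eval v t = eval v u
  | Rel r ts => rinterp (fun i => eval v (ts i))
  | Neg psi => ~ sat v psi
  | Imp psi chi => sat v psi -> sat v chi
  | All x psi => forall a, sat (upd v x a) psi
  end.

Definition models (phi : formula L) := forall v, sat v phi.

Definition Th : set (formula L) := [set phi | sentence phi /\ models phi].

(* Used for formulas with no free variable other than [x], so that the
   valuation of the other variables does not matter. *)
Definition defined_set (phi : formula L) (x : nat) : set (universe A) :=
  [set b | forall v, v x = b -> sat v phi].

Definition term_for (t : term L) (a : universe A) :=
  closed_term t /\ defined_set (Eq (Var L 0) t) 0 = [set a].

End Semantics.

(* Main.v *)
Require Import Defs.
From mathcomp Require Import all_boot.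
From mathcomp Require Import boolp classical_sets.

Set Implicit Arguments.
Unset Strict Implicit.
Unset Printing Implicit Defensive.

(** Soundness is an induction on derivations: an open formula provable from [T]
is true because its universal closure is, and the S-rule preserves truth because
every element of the model is named by a term of [S]. For completeness, an
induction on [phi] shows that, for every valuation [e] in the model, the closed
instance of [phi] that names the values of [e] is provable if [e] satisfies
[phi] and refutable otherwise; the S-rule is what proves the true universal
formulas. *)

Local Open Scope classical_set_scope.

Lemma upd_same (X : Type) (v : nat -> X) x : upd v x (v x) = v.
Proof. by apply: funext => y; rewrite /upd; case: eqP => [->|]. Qed.

Lemma upd_comp (X Y : Type) (f : X -> Y) (v : nat -> X) x a :
  upd (f \o v) x (f a) = f \o upd v x a.
Proof. by apply: funext => y; rewrite /upd /=; case: eqP. Qed.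

(** * Substitution of closed terms, and bounds on free variables *)

Section Substitution.
Variable L : vocabulary.
Implicit Types (s : nat -> term L) (u : term L) (phi : formula L).

Lemma eq_tsubst s1 s2 u :
  (forall x, occurs x u -> s1 x = s2 x) -> tsubst s1 u = tsubst s2 u.
Proof.
elim: u => [x|f ts IH] eq_s /=; first exact: eq_s.
by congr App; apply: funext => i; apply: IH => x xi; apply: eq_s; exists i.
Qed.

Lemma eq_fsubst s1 s2 phi :
  (forall x, free x phi -> s1 x = s2 x) -> fsubst s1 phi = fsubst s2 phi.
Proof.
elim: phi s1 s2 => [u w|r ts|psi IH|psi IH1 chi IH2|x psi IH] s1 s2 eq_s /=.
- by congr Eq; apply: eq_tsubst => x xu; apply: eq_s; [left|right].
- congr Rel; apply: funext => i; apply: eq_tsubst => x xi.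
  by apply: eq_s; exists i.
- by congr Neg; apply: IH.
- by congr Imp; [apply: IH1|apply: IH2] => x xf; apply: eq_s; [left|right].
- congr All; apply: IH => y yf; rewrite /upd.
  by case: eqP => // yx; apply: eq_s.
Qed.

Lemma tsubst_Var u : tsubst (@Var L) u = u.
Proof.
by elim: u => [//|f ts IH] /=; congr App; apply: funext => i; apply: IH.
Qed.

Lemma fsubst_Var phi : fsubst (@Var L) phi = phi.
Proof.
elim: phi => [u w|r ts|psi IH|psi IH1 chi IH2|x psi IH] /=.
- by rewrite !tsubst_Var.
- by congr Rel; apply: funext => i; rewrite tsubst_Var.
- by rewrite IH.
- by rewrite IH1 IH2.
- by rewrite upd_same IH.
Qed.

Lemma fsubst_sentence s phi : sentence phi -> fsubst s phi = phi.
Proof.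
by move=> phi_cl; rewrite -[RHS]fsubst_Var; apply: eq_fsubst => x /phi_cl.
Qed.

Lemma tsubst_closed s u : closed_term u -> tsubst s u = u.
Proof.
by move=> u_cl; rewrite -[RHS]tsubst_Var; apply: eq_tsubst => x /u_cl.
Qed.

(* No capture can happen under such a substitution, and [fsubst] preserves the
   condition when it goes under a quantifier. *)
Definition closed_or_id s := forall y, s y = Var L y \/ closed_term (s y).

Lemma closed_or_id_upd s x :
  closed_or_id s -> closed_or_id (upd s x (Var L x)).
Proof. by move=> sP y; rewrite /upd; case: eqP => [->|_]; [left|]. Qed.

Lemma closed_or_id_upd_Var x u :
  closed_term u -> closed_or_id (upd (@Var L) x u).
Proof. by move=> u_cl y; rewrite /upd; case: eqP => _; [right|left]. Qed.

(** For such [s], the condition [occurs y (s y)] says exactly that [s] leaves [y] fixed; no other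
    [s x] can bring in [y]. *)
Lemma occurs_tsubst s y u : closed_or_id s ->
  occurs y (tsubst s u) <-> occurs y u /\ occurs y (s y).
Proof.
move=> sP; elim: u => [x|f ts IH] /=.
  split=> [ys|[-> //]].
  by case: (sP x) => sx; [move: ys; rewrite sx /= => ->; rewrite sx|case: (sx y)].
by split=> [[i /IH[? ?]]|[[i yi] ys]]; [split=> //; exists i|exists i; apply/IH].
Qed.

Lemma free_fsubst s y phi : closed_or_id s ->
  free y (fsubst s phi) <-> free y phi /\ occurs y (s y).
Proof.
elim: phi s => [u w|r ts|psi IH|psi IH1 chi IH2|x psi IH] s sP /=.
- have := occurs_tsubst y u sP; have := occurs_tsubst y w sP; tauto.
- split=> [[i /(occurs_tsubst y _ sP)[? ?]]|[[i yi] ys]].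
    by split=> //; exists i.
  by exists i; apply/occurs_tsubst.
- exact: IH.
- have := IH1 s sP; have := IH2 s sP; tauto.
- have := IH _ (closed_or_id_upd x sP); rewrite /upd.
  by case: eqP => yx; tauto.
Qed.

Lemma tsubst_comp s1 s2 u :
  tsubst s2 (tsubst s1 u) = tsubst (tsubst s2 \o s1) u.
Proof.
by elim: u => [//|f ts IH] /=; congr App; apply: funext => i; apply: IH.
Qed.

(** For general [s1] this fails: a term inserted under a quantifier may contain the bound variable,
    which [s2] then leaves alone. *)
Lemma fsubst_comp s1 s2 phi : closed_or_id s1 ->
  fsubst s2 (fsubst s1 phi) = fsubst (tsubst s2 \o s1) phi.
Proof.
elim: phi s1 s2 => [u w|r ts|psi IH|psi IH1 chi IH2|x psi IH] s1 s2 s1P /=.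
- by rewrite !tsubst_comp.
- by congr Rel; apply: funext => i; rewrite tsubst_comp.
- by rewrite IH.
- by rewrite IH1 // IH2.
- rewrite IH; last exact: closed_or_id_upd.
  congr (All x (fsubst _ _)); apply: funext => y; rewrite /upd /=.
  case: eqP => [_|yx] /=; first by rewrite eqxx.
  case: (s1P y) => [-> /=|cl]; last by rewrite !tsubst_closed.
  by case: eqP.
Qed.

Lemma free_for_closed u x phi : closed_term u -> free_for u x phi.
Proof.
move=> u_cl; elim: phi => [||||y psi IH] //=.
by right; split=> //; apply: u_cl.
Qed.

(** The left side is the form in which instances appear in [ax_inst] and the S-rule, the right side
    the form that suits an induction on formulas. *)
Lemma fsubst1_upd s x u phi : (forall y, closed_term (s y)) ->
  fsubst1 (fsubst (upd s x (Var L x)) phi) x u = fsubst (upd s x u) phi.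
Proof.
move=> s_cl; rewrite /fsubst1 fsubst_comp.
  congr fsubst; apply: funext => y; rewrite /upd /=.
  by case: eqP => _ /=; [rewrite eqxx|rewrite tsubst_closed].
by apply: closed_or_id_upd => y; right.
Qed.

Lemma occurs_bounded u : exists n, forall x, occurs x u -> x < n.
Proof.
elim: u => [y|f ts /choice[g gP]] /=.
  by exists y.+1 => x ->; exact: leqnn.
exists (\max_i g i) => x [i /gP xi].
exact: leq_trans xi (leq_bigmax i).
Qed.

Lemma free_bounded phi : exists n, forall x, free x phi -> x < n.
Proof.
elim: phi => [u w|r ts|psi IH|psi [n nP] chi [m mP]|x psi [n nP]] //=.
- have [n nP] := occurs_bounded u; have [m mP] := occurs_bounded w.
  by exists (maxn n m) => x [/nP|/mP] xlt; rewrite leq_max xlt ?orbT.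
- have [g gP] := choice (fun i => occurs_bounded (ts i)).
  exists (\max_i g i) => x [i /gP xi].
  exact: leq_trans xi (leq_bigmax i).
- by exists (maxn n m) => x [/nP|/mP] xlt; rewrite leq_max xlt ?orbT.
- by exists n => y [_ /nP].
Qed.

Lemma free_foldr_All y xs phi :
  free y (foldr (@All L) phi xs) -> y \notin xs /\ free y phi.
Proof.
elim: xs => [//|x xs IH] /= [yx /IH[yxs yphi]]; split=> //.
by rewrite in_cons negb_or yxs andbT; apply/eqP.
Qed.

Lemma universal_closure phi : exists xs, sentence (foldr (@All L) phi xs).
Proof.
have [n nP] := free_bounded phi.
exists (iota 0 n) => y /free_foldr_All[ynotin /nP yn].
by rewrite mem_iota add0n yn in ynotin.
Qed.

End Substitution.

(** * Semantics of substitution and of naming terms *)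

Section Satisfaction.
Variables (L : vocabulary) (A : model L).
Implicit Types (s : nat -> term L) (v : nat -> universe A).

Lemma eval_tsubst v s (u : term L) :
  eval v (tsubst s u) = eval (eval v \o s) u.
Proof.
by elim: u => [//|f ts IH] /=; congr finterp; apply: funext => i; apply: IH.
Qed.

Lemma eval_closed v1 v2 (u : term L) : closed_term u -> eval v1 u = eval v2 u.
Proof.
have coin : forall w, (forall x, occurs x w -> v1 x = v2 x) ->
    eval v1 w = eval v2 w.
  elim=> [x|f ts IH] eq_v /=; first exact: eq_v.
  congr finterp; apply: funext => i.
  by apply: IH => x xi; apply: eq_v; exists i.
by move=> u_cl; apply: coin => x /u_cl.
Qed.

Lemma sat_fsubst v s (phi : formula L) : closed_or_id s ->
  sat v (fsubst s phi) <-> sat (eval v \o s) phi.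
Proof.
elim: phi v s => [u w|r ts|psi IH|psi IH1 chi IH2|x psi IH] v s sP /=.
- by rewrite !eval_tsubst.
- have -> // : (fun i => eval v (tsubst s (ts i)))
             = (fun i => eval (eval v \o s) (ts i)).
  by apply: funext => i; rewrite eval_tsubst.
- have := IH v s sP; tauto.
- have := IH1 v s sP; have := IH2 v s sP; tauto.
(* Away from [x], each [s y] is [Var y] or closed, so its value ignores the update at [x]. *)
- have E a : eval (upd v x a) \o upd s x (Var L x) = upd (eval v \o s) x a.
    apply: funext => y; rewrite /upd /=; case: eqP => [_|yx] /=.
      by rewrite eqxx.
    case: (sP y) => [-> /=|cl]; last exact: eval_closed.
    by case: eqP.
  have IHx a := IH (upd v x a) _ (closed_or_id_upd x sP).
  by split=> H a; have := H a; rewrite IHx E.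
Qed.

Lemma models_foldr_All xs (phi : formula L) :
  models A (foldr (@All L) phi xs) -> models A phi.
Proof.
elim: xs => [//|x xs IH] /= H; apply: IH => v.
by have := H v (v x); rewrite upd_same.
Qed.

Lemma eval_term_for (u : term L) (a : universe A) v :
  term_for u a -> eval v u = a.
Proof.
case=> u_cl defu.
have : defined_set (Eq (Var L 0) u) 0 a by rewrite defu.
(* The defining formula uses variable 0, so it is read at a valuation sending 0 to [a]; the closed
   term [u] does not see this change. *)
by move=> /(_ (upd v 0 a) erefl) /= Ea; rewrite [RHS]Ea; apply: eval_closed.
Qed.

End Satisfaction.

(** * Derived rules, valid in any set containing the axioms and closed under the first-order
    rules *)

Section Calculus.
Variables (L : vocabulary) (X : set (formula L)).
Hypotheses (Xax : @fo_axiom L `<=` X) (Xclo : closed_under (@fo_rule L) X).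
Implicit Types a b c : formula L.

Lemma mp a b : X (Imp a b) -> X a -> X b.
Proof.
by move=> Xab Xa; apply: Xclo (modus_ponens a b) _ => _ [->|->].
Qed.

Lemma gen x a : X a -> X (All x a).
Proof. by move=> Xa; apply: Xclo (generalization x a) _ => _ ->. Qed.

Lemma imp_weaken a b : X b -> X (Imp a b).
Proof. by apply: mp; apply: Xax; apply: ax_K. Qed.

Lemma imp_dist a b c : X (Imp a (Imp b c)) -> X (Imp a b) -> X (Imp a c).
Proof.
by move=> Xabc; apply: mp; apply: mp Xabc; apply: Xax; apply: ax_S.
Qed.

Lemma imp_trans a b c : X (Imp a b) -> X (Imp b c) -> X (Imp a c).
Proof. by move=> Xab Xbc; apply: imp_dist Xab; apply: imp_weaken. Qed.

Lemma imp_refl a : X (Imp a a).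
Proof. by apply: (@imp_dist a (Imp a a)); apply: Xax; apply: ax_K. Qed.

Lemma neg_imp a b : X (Imp (Neg a) (Imp a b)).
Proof.
apply: (@imp_trans _ (Imp (Neg b) (Neg a))); apply: Xax; first exact: ax_K.
exact: ax_contra.
Qed.

Lemma imp_of_neg a b : X (Neg a) -> X (Imp a b).
Proof. exact/mp/neg_imp. Qed.

Lemma nnE a : X (Imp (Neg (Neg a)) a).
Proof.
apply: imp_dist (imp_refl _).
(* From the double negation of [a], explosion yields [Neg a] implies its own double negation;
   [ax_contra] turns this into an implication from [Neg (Neg a)] to [a]. The repeated premise was
   contracted by [imp_dist]. *)
by apply: imp_trans (neg_imp _ (Neg (Neg (Neg a)))) _; apply/Xax/ax_contra.
Qed.

Lemma nnI a : X (Imp a (Neg (Neg a))).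
Proof. by apply: mp (nnE _); apply/Xax/ax_contra. Qed.

Lemma contrapose a b : X (Imp a b) -> X (Imp (Neg b) (Neg a)).
Proof.
move=> Xab; apply: mp; first exact/Xax/ax_contra.
exact: imp_trans (imp_trans (nnE a) Xab) (nnI b).
Qed.

(** Once [a] is provable, [Imp a b] implies [b]; contrapose. *)
Lemma neg_of_imp a b : X a -> X (Neg b) -> X (Neg (Imp a b)).
Proof.
move=> Xa; apply: mp; apply: contrapose.
exact: imp_dist (imp_refl _) (imp_weaken _ Xa).
Qed.

Lemma neg_All x a (u : term L) :
  closed_term u -> X (Neg (fsubst1 a x u)) -> X (Neg (All x a)).
Proof.
move=> u_cl; apply: mp; apply: contrapose.
by apply/Xax/ax_inst/free_for_closed.
Qed.

Lemma gen_foldr_All xs a : X a -> X (foldr (@All L) a xs).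
Proof. by move=> Xa; elim: xs => [|x xs] //=; apply: gen. Qed.

End Calculus.

(** * Soundness and completeness of the S-rule in a model with named elements *)

Section Omega.
Variables (L : vocabulary) (A : model L) (t : universe A -> term L).
Hypothesis ht : forall a, term_for (t a) a.

Lemma S_provable_sound (T : set (formula L)) (pr : provability L) phi :
  theory T -> provability_relation pr -> theorems T pr `<=` Th A ->
  S_provable pr (range t) T phi -> models A phi.
Proof.
move=> hT hpr hsound; have [_ clo] := hpr T hT.
elim=> {phi} [phi Tphi|Gamma phi [] R _ IH].
- have [xs xs_cl] := universal_closure phi.
  suff [_] : Th A (foldr (@All L) phi xs) by apply: models_foldr_All.
  by apply: hsound; split=> //; apply: gen_foldr_All.
- case: R IH => [a b|x a] IH v.
    have /= Hab := IH (Imp a b) (or_intror erefl) v.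
    by apply: Hab; apply: IH; left.
  by move=> b /=; apply: IH.
- case: R IH => {}phi x _ IH v a /=.
  have ta_cl : closed_term (t a) by case: (ht a).
  have /(_ v) := IH _ (imageP _ (imageT t a)).
  rewrite sat_fsubst; last exact: closed_or_id_upd_Var.
  (* Since [t a] has value [a], the premise for [t a] is the truth of the body at [upd v x a]. *)
  by rewrite -upd_comp (eval_term_for _ (ht a)).
Qed.

(** Each naming term evaluates back to the element it names under every [v], so only [e] matters. *)
Lemma sat_name (e v : nat -> universe A) (phi : formula L) :
  sat v (fsubst (t \o e) phi) <-> sat e phi.
Proof.
rewrite sat_fsubst; last by move=> y; right; case: (ht (e y)).
suff -> : eval v \o (t \o e) = e by [].
by apply: funext => y /=; apply: eval_term_for.
Qed.

(* Negation swaps the two halves, so they have to be proved together. *)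
Lemma S_complete_name (X : set (formula L)) phi e :
    @fo_axiom L `<=` X -> closed_under (@fo_rule L) X ->
    closed_under (S_rule (range t)) X ->
    (forall psi e', literal psi -> sat e' psi -> X (fsubst (t \o e') psi)) ->
  (sat e phi -> X (fsubst (t \o e) phi)) /\
  (~ sat e phi -> X (Neg (fsubst (t \o e) phi))).
Proof.
move=> Xax Xclo XS Xlit.
(* The negation of an atom is again a literal, so [Xlit] yields both halves. *)
have Xatom psi e' : atomic psi ->
    (sat e' psi -> X (fsubst (t \o e') psi)) /\
    (~ sat e' psi -> X (Neg (fsubst (t \o e') psi))).
  move=> psiP; split; first by apply: Xlit; left.
  by apply: (Xlit (Neg psi)); right; exists psi.
have t_cl a : closed_term (t a) by case: (ht a).
elim: phi e => [u w|r ts|psi IH|psi IH1 chi IH2|x psi IH] e; try exact: Xatom.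
- have [pos neg] := IH e; split=> [//|] /contrapT /pos.
  by apply: (mp Xclo); apply: nnI.
- have [pos1 neg1] := IH1 e; have [pos2 neg2] := IH2 e; split=> /=.
    move=> H; have [/H /pos2|/neg1] := pselect (sat e psi).
      exact: imp_weaken.
    exact: imp_of_neg.
  by move=> /not_implyP[/pos1 ? /neg2 ?]; apply: neg_of_imp.
have inst a : fsubst1 (fsubst (upd (t \o e) x (Var L x)) psi) x (t a)
    = fsubst (t \o upd e x a) psi.
  by rewrite fsubst1_upd ?upd_comp // => y; apply: t_cl.
(* A false universal formula has a counterexample [a], and its refuted instance at [t a] refutes
   it. *)
split=> [H|/existsNP[a /(proj2 (IH _))]] /=; last first.
  by rewrite -inst; apply: neg_All.
have Xinst a : X (fsubst (t \o upd e x a) psi) by apply: (proj1 (IH _)).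
(* The S-rule only applies when [x] really is free in the body. *)
have [xfree|xnfree] := pselect (free x psi).
  apply: XS.
    apply: S_rule_intro => y; rewrite free_fsubst.
      (* The S-rule needs [x] as the only free variable: every other variable has been replaced by a
         closed term. *)
      rewrite /upd; case: eqP => [->|yx]; first by split.
      by split=> // -[_ /t_cl].
    by apply: closed_or_id_upd => z; right; apply: t_cl.
  by move=> _ [_ [a _ <-] <-]; rewrite inst.
(* With [x] not free, any instance is the body itself; the element [e x] is chosen because updating
   [e] by it changes nothing. *)
apply: (gen Xclo); move: (Xinst (e x)); congr X.
by apply: eq_fsubst => y yf; rewrite upd_same /upd; case: eqP yf => // ->.
Qed.

End Omega.

Unset Implicit Arguments.

Theorem theorem2 (L : vocabulary) (A : model L)
    (t : universe A -> term L) (T : set (formula L)) (pr : provability L)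
    (ht : forall a, term_for (t a) a)
    (hT : theory T)
    (hpr : provability_relation pr)
    (hsound : theorems T pr `<=` Th A)
    (hlit : forall (phi : formula L) (s : nat -> term L),
        literal phi -> (forall x, free x phi -> range t (s x)) ->
        (pr T (fsubst s phi) <-> models A (fsubst s phi))) :
  (forall sigma : formula L, sentence sigma ->
     (S_provable pr (range t) T sigma <-> models A sigma))
  /\ theorems T (S_provable pr (range t)) = Th A.
Proof.
suff main sigma : sentence sigma ->
    (S_provable pr (range t) T sigma <-> models A sigma).
  split=> //; apply/seteqP.
  by split=> sigma [sigma_cl /(main _ sigma_cl) ?].
move=> sigma_cl; split; first exact: S_provable_sound.
(* Any valuation serves, here a constant one: substituting names leaves the sentence [sigma]
   unchanged. *)
have [a0] := universe_inhabited A => /(_ (fun=> a0)) sat_sigma.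
have [sub clo] := S_provable_provability (range t) hpr hT.
rewrite -(fsubst_sentence (t \o fun=> a0) sigma_cl).
apply: (proj1 (S_complete_name ht sigma _ _ clo _ _)) sat_sigma.
- by move=> phi phi_ax; apply: sub; right.
- by move=> Gamma phi R; apply: gen_rule; right.
move=> phi e phi_lit sat_phi; apply: gen_base.
by apply/hlit => // v; rewrite sat_name.
Qed.
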